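(* Let $\mathcal{T}=(S_1,S_2,T)$ and $\mathcal{T}'=(S_1',S_2',T')$ be admissible triples for $\mathrm{sl}(n)$ with $\mathcal{T}\prec\mathcal{T}'$, and let $r'=\gamma+\beta+\alpha(\mathcal{T}')$ be a solution of the modified classical Yang–Baxter equation associated to $\mathcal{T}'$, where $\beta\in\mathfrak{h}\wedge\mathfrak{h}$. Then $r=\gamma+\beta+\alpha(\mathcal{T})$ is in the closure of the orbit of $r'$ under the operation of $\mathrm{SL}(n)$.
   Context: $K$ is a field of characteristic zero and $\mathfrak{g}=\mathrm{sl}(n)=\mathfrak{n}^-\oplus\mathfrak{h}\oplus\mathfrak{n}^+$ is the standard triangular decomposition ($\mathfrak{h}$ the traceless diagonal matrices, $\mathfrak{n}^{\pm}$ the strictly upper/lower triangular matrices); $e_{ij}$ are the matrix units, and $a\wedge b=a\otimes b-b\otimes a$. An element $r\in\mathfrak{g}\wedge\mathfrak{g}$ is a solution of the modified classical Yang–Baxter equation (MCYBE) if the Schouten bracket $[r,r]$ is a non-zero $\mathfrak{g}$-invariant element of $\mathfrak{g}\wedge\mathfrak{g}\wedge\mathfrak{g}$. The group $\mathrm{SL}(n)$ operates on $\mathfrak{g}\wedge\mathfrak{g}$ through the adjoint action (conjugation on both factors); closure is Zariski closure in the finite-dimensional vector space $\mathfrak{g}\wedge\mathfrak{g}$. The simple roots of $\mathrm{sl}(n)$ are identified with $\{1,\dots,n-1\}$, $i$ corresponding to the root vector $e_{i,i+1}$. An admissible triple $\mathcal{T}=(S_1,S_2,T)$ is a bijection $T:S_1\to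 S_2$ between subsets of $\{1,\dots,n-1\}$ such that (1) for every $i\in S_1$ there is an $r\ge 1$ with $T^r(i)\notin S_1$ (iterating as long as the images lie in $S_1$), and (2) $T$ preserves adjacency: for $i,j\in S_1$, $|i-j|=1$ if and only if $|T(i)-T(j)|=1$. Write $(S_1,S_2,T)\prec(S_1',S_2',T')$ if $S_1\subset S_1'$ and $T$ is the restriction of $T'$ to $S_1$. Set $\gamma=\sum_{i<j}e_{ij}\wedge e_{ji}$. For an admissible triple $\mathcal{T}$, the element $\alpha(\mathcal{T})\in\mathfrak{n}^+\wedge\mathfrak{n}^-$ is the Belavin–Drinfel'd term determined by $\mathcal{T}$: let $\mathfrak{n}_{S_k}$ be the Lie subalgebra of $\mathfrak{n}^+$ generated by the $e_{i,i+1}$, $i\in S_k$ ($k=1,2$), and let $\theta:\mathfrak{n}_{S_1}\to\mathfrak{n}_{S_2}$ be the Lie algebra isomorphism with $\theta(e_{i,i+1})=e_{T(i),T(i)+1}$. Then $$\alpha(\mathcal{T})=2\sum_{i<j,\ e_{ij}\in\mathfrak{n}_{S_1}}\ \sum_{k\ge1}\theta^k(e_{ij})\wedge e_{ji},$$ where for each $(i,j)$ the inner sum is over those $k\ge1$ for which $\theta^k(e_{ij})$ is defined, i.e. $\theta^l(e_{ij})\in\mathfrak{n}_{S_1}$ for $0\le l<k$. A solution associated to $\mathcal{T}'$ is one of the form $\gamma+\beta+\alpha(\mathcal{T}')$ with $\beta\in\mathfrak{h}\wedge\mathfrak{h}$. *)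

(* Defs.v *)
From HB Require Import structures.
From mathcomp Require Import all_boot all_order all_algebra.
From mathcomp Require Import mxtens mpoly.
From mathcomp Require Import ring.

Set Implicit Arguments.
Unset Strict Implicit.
Unset Printing Implicit Defensive.

Import GRing.Theory.
Local Open Scope ring_scope.

(* The tensor powers of gl(n) are realized by Kronecker products: gl(n)^{(x)2}
   is 'M_(n * n) with a (x) b = a *t b, and gl(n)^{(x)3} is 'M_(n * n * n) with
   a (x) b (x) c = (a *t b) *t c. *)

Section LieAlgebra.

Variables (K : fieldType) (n : nat).
Local Notation M := 'M[K]_n.

Definition lie m (x y : 'M[K]_m) : 'M[K]_m := x *m y - y *m x.

Definition sl : pred M := fun x => \tr x == 0.

Definition cartan : pred M := fun x => is_diag_mx x && (\tr x == 0).

(* The Lie subalgebra generated by X; see subset_lie_closure,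
   lie_closure_closed and lie_closure_min. *)
Definition lie_step (V : {vspace M}) : {vspace M} :=
  (V + <<[seq lie x y | x <- vbasis V, y <- vbasis V]>>)%VS.

Definition lie_closure (X : seq M) : {vspace M} :=
  iter (n * n) lie_step <<X>>%VS.

Definition wedge (a b : M) : 'M[K]_(n * n) := a *t b - b *t a.

Definition wedge3 (a b c : M) : 'M[K]_(n * n * n) :=
  a *t b *t c + b *t c *t a + c *t a *t b
  - b *t a *t c - a *t c *t b - c *t b *t a.

(* The exterior square of a subspace of gl(n) with membership predicate P. *)
Definition in_wedge2 (P : pred M) (r : 'M[K]_(n * n)) : Prop :=
  exists2 s : seq (M * M), all (fun p => P p.1 && P p.2) s
    & r = \sum_(p <- s) wedge p.1 p.2.

Definition in_wedge3 (P : pred M) (w : 'M[K]_(n * n * n)) : Prop :=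
  exists2 s : seq (M * M * M), all (fun p => [&& P p.1.1, P p.1.2 & P p.2]) s
    & w = \sum_(p <- s) wedge3 p.1.1 p.1.2 p.2.

(* The Schouten bracket [a /\ b, c /\ d] of decomposable bivectors. *)
Definition schouten_dec (a b c d : M) : 'M[K]_(n * n * n) :=
  wedge3 (lie a c) b d - wedge3 (lie a d) b c
  - wedge3 (lie b c) a d + wedge3 (lie b d) a c.

Definition delta_pair (u : 'I_n * 'I_n) : M := delta_mx u.1 u.2.

(* The coefficient of delta_pair u (x) delta_pair v in r. *)
Definition tcoef (r : 'M[K]_(n * n)) (u v : 'I_n * 'I_n) : K :=
  r (mxtens_index (u.1, v.1)) (mxtens_index (u.2, v.2)).

(* Bilinear extension of schouten_dec in characteristic <> 2, where a
   skew-symmetric r is the sum over u, v of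
   (tcoef r u v / 2) *: wedge (delta_pair u) (delta_pair v);
   see schouten_wedge. *)
Definition schouten (r s : 'M[K]_(n * n)) : 'M[K]_(n * n * n) :=
  \sum_u \sum_v \sum_w \sum_z (tcoef r u v / 2%:R * (tcoef s w z / 2%:R)) *:
    schouten_dec (delta_pair u) (delta_pair v) (delta_pair w) (delta_pair z).

(* On gl(n)^{(x)3} the adjoint action of x is the commutator with
   x (x) 1 (x) 1 + 1 (x) x (x) 1 + 1 (x) 1 (x) x; see ad3_tens. *)
Definition ad3 (x : M) (w : 'M[K]_(n * n * n)) : 'M[K]_(n * n * n) :=
  lie (x *t (1%:M : M) *t (1%:M : M) + (1%:M : M) *t x *t (1%:M : M)
       + (1%:M : M) *t (1%:M : M) *t x) w.

Definition MCYBE (r : 'M[K]_(n * n)) : Prop :=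
  [/\ in_wedge2 sl r, in_wedge3 sl (schouten r r), schouten r r != 0
    & forall x, sl x -> ad3 x (schouten r r) = 0].

(* Ad(g) (x) Ad(g); see Ad2_tens. *)
Definition Ad2 (g : M) (r : 'M[K]_(n * n)) : 'M[K]_(n * n) :=
  (g *t g) *m r *m (invmx g *t invmx g).

Definition SL_orbit (r s : 'M[K]_(n * n)) : Prop :=
  exists2 g : M, \det g = 1 & s = Ad2 g r.

End LieAlgebra.

(* Zariski closure in the linear subspace W of 'M_m. The polynomial functions
   on W are the restrictions to W of the polynomials in the matrix entries. *)
Definition zariski_closure (K : fieldType) m (W A : 'M[K]_m -> Prop)
    (x : 'M[K]_m) : Prop :=
  W x /\ forall p : {mpoly K[m * m]},
    (forall y, W y -> A y -> p.@[fun i => mxvec y 0 i] = 0) ->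
    p.@[fun i => mxvec x 0 i] = 0.

(* Simple roots are indexed from 0: i : 'I_n.-1 stands for the root i + 1.
   Only the restriction of tmap to tdom is meaningful. *)
Record triple n := Triple {
  tdom : {set 'I_n.-1};
  tcod : {set 'I_n.-1};
  tmap : 'I_n.-1 -> 'I_n.-1
}.

Definition adjacent n (i j : 'I_n) : bool := (i.+1 == j) || (j.+1 == i).

Definition admissible n (t : triple n) : Prop :=
  [/\ tmap t @: tdom t = tcod t,
      {in tdom t &, injective (tmap t)},
      forall i, i \in tdom t -> exists r,
        [/\ (0 < r)%N, forall l, (l < r)%N -> iter l (tmap t) i \in tdom t
          & iter r (tmap t) i \notin tdom t]
    & {in tdom t &, forall i j, adjacent i j = adjacent (tmap t i) (tmap t j)}].

Definition triple_prec n (t t' : triple n) : Prop :=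
  tdom t \subset tdom t' /\ {in tdom t, tmap t =1 tmap t'}.

Section BelavinDrinfeld.

Variables (K : fieldType) (n : nat).
Local Notation M := 'M[K]_n.

(* e_{i,i+1} *)
Definition simple_mx (i : 'I_n.-1) : M :=
  \matrix_(a, b) ((a == i :> nat) && (b == i.+1 :> nat))%:R.

Definition nilp (S : {set 'I_n.-1}) : {vspace M} :=
  lie_closure [seq simple_mx i | i <- enum S].

(* theta restricts to the Lie algebra isomorphism n_{S_1} -> n_{S_2} determined
   by T; its values outside n_{S_1} are irrelevant. *)
Definition BD_iso (t : triple n) (theta : 'End(M)) : Prop :=
  [/\ (theta @: nilp (tdom t))%VS = nilp (tcod t),
      {in nilp (tdom t) &, injective theta},
      {in nilp (tdom t) &, {morph theta : x y / lie x y}}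
    & {in tdom t, forall i, theta (simple_mx i) = simple_mx (tmap t i)}].

Definition gamma : 'M[K]_(n * n) :=
  \sum_(i < n) \sum_(j < n | (i < j)%N)
    wedge (delta_mx i j : M) (delta_mx j i).

(* For t admissible, theta^k(e_ij) is never defined for k >= n: the set S_1 has
   at most n - 1 elements and the T-orbits in it do not cycle. *)
Definition BD_alpha (t : triple n) (theta : 'End(M)) : 'M[K]_(n * n) :=
  2%:R *: \sum_(i < n)
    \sum_(j < n | (i < j)%N && ((delta_mx i j : M) \in nilp (tdom t)))
    \sum_(1 <= k < n | [forall l : 'I_k,
                          iter l theta (delta_mx i j) \in nilp (tdom t)])
      wedge (iter k theta (delta_mx i j)) (delta_mx j i).

End BelavinDrinfeld.

Section Facts.

Variables (K : fieldType) (n : nat).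
Local Notation M := 'M[K]_n.

Let linD (V W : lmodType K) (f : V -> W) : linear f -> {morph f : x y / x + y}.
Proof. by move=> lf x y; rewrite -[x]scale1r lf !scale1r. Qed.

Let lin0 (V W : lmodType K) (f : V -> W) : linear f -> f 0 = 0.
Proof. by move=> lf; apply: (@addIr _ (f 0)); rewrite -linD // !add0r. Qed.

Let linZ (V W : lmodType K) (f : V -> W) : linear f ->
  forall k x, f (k *: x) = k *: f x.
Proof. by move=> lf k x; rewrite -[k *: x]addr0 lf lin0 // addr0. Qed.

Let lin_sum (V W : lmodType K) (f : V -> W) I (r : seq I) P F : linear f ->
  f (\sum_(i <- r | P i) F i) = \sum_(i <- r | P i) f (F i).
Proof. by move=> lf; apply: big_morph; [apply: linD | apply: lin0]. Qed.

Lemma lie_linl m (y : 'M[K]_m) : linear (fun x : 'M[K]_m => lie x y).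
Proof.
move=> k a b; rewrite /lie mulmxDl mulmxDr -scalemxAl -scalemxAr scalerBr.
by rewrite opprD addrACA.
Qed.

Lemma lie_linr m (x : 'M[K]_m) : linear (lie x : 'M[K]_m -> 'M[K]_m).
Proof.
move=> k a b; rewrite /lie mulmxDl mulmxDr -scalemxAl -scalemxAr scalerBr.
by rewrite opprD addrACA.
Qed.

Lemma subset_lie_closure (X : seq M) : {subset X <= lie_closure X}.
Proof.
move=> x xX; rewrite /lie_closure; elim: (n * n)%N => [|k IH] /=.
  exact: memv_span.
by apply: (subvP (addvSl _ _)).
Qed.

Lemma lie_step_lie (V : {vspace M}) x y :
  x \in V -> y \in V -> lie x y \in lie_step V.
Proof.
move=> xV yV; apply: (subvP (addvSr _ _)).
rewrite (coord_vbasis xV) (lin_sum _ _ _ (lie_linl _)).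
apply: memv_suml => i _; rewrite (linZ (lie_linl _)) memvZ //.
rewrite (coord_vbasis yV) (lin_sum _ _ _ (lie_linr _)).
apply: memv_suml => j _; rewrite (linZ (lie_linr _)) memvZ //.
by apply: memv_span; apply: allpairs_f; rewrite mem_nth // size_tuple.
Qed.

Lemma lie_closure_closed (X : seq M) :
  {in lie_closure X &, forall x y, lie x y \in lie_closure X}.
Proof.
have H k : lie_step (iter k (@lie_step K n) <<X>>%VS)
             = iter k (@lie_step K n) <<X>>%VS
           \/ (k <= \dim (iter k (@lie_step K n) <<X>>%VS))%N.
  elim: k => [|k [IH|IH]]; first by right.
    by left; rewrite iterS !IH.
  have s1 : (iter k (@lie_step K n) <<X>> <= iter k.+1 (@lie_step K n) <<X>>)%VS
    by rewrite iterS addvSl.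
  have [le|lt] := leqP (\dim (iter k.+1 (@lie_step K n) <<X>>%VS))
                       (\dim (iter k (@lie_step K n) <<X>>%VS)).
    have E : iter k (@lie_step K n) <<X>>%VS
             = iter k.+1 (@lie_step K n) <<X>>%VS.
      by apply/eqP; rewrite eqEdim s1.
    by left; rewrite -E {2}E iterS.
  by right; apply: leq_ltn_trans lt.
move=> x y xL yL; have := lie_step_lie xL yL; rewrite /lie_closure.
case: (H (n * n)%N) => [-> //|le].
have /eqP -> : iter (n * n) (@lie_step K n) <<X>>%VS == fullv.
  by rewrite eqEdim subvf dimvf.
by rewrite memvf.
Qed.

Lemma lie_closure_min (X : seq M) (V : {vspace M}) : {subset X <= V} ->
  {in V &, forall x y, lie x y \in V} -> (lie_closure X <= V)%VS.
Proof.
move=> XV VV; rewrite /lie_closure; elim: (n * n)%N => [|k IH] /=.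
  exact/span_subvP.
rewrite subv_add IH; apply/span_subvP => _ /allpairsP[p [p1 p2 ->]].
by apply: VV; apply: (subvP IH); apply: vbasis_mem.
Qed.

Lemma tens_linl m p (y : 'M[K]_p) : linear (fun x : 'M[K]_m => x *t y).
Proof.
by move=> k a b; apply/matrixP => i j; rewrite !mxE mulrDl mulrA.
Qed.

Lemma tens_linr m p (x : 'M[K]_m) : linear (fun y : 'M[K]_p => x *t y).
Proof.
by move=> k a b; apply/matrixP => i j; rewrite !mxE mulrDr mulrCA.
Qed.

Lemma wedge3_lin1 b c : linear (fun a : M => wedge3 a b c).
Proof. by move=> k x y; apply/matrixP => i j; rewrite !mxE; ring. Qed.

Lemma wedge3_lin2 a c : linear (fun b : M => wedge3 a b c).
Proof. by move=> k x y; apply/matrixP => i j; rewrite !mxE; ring. Qed.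

Lemma wedge3_lin3 a b : linear (fun c : M => wedge3 a b c).
Proof. by move=> k x y; apply/matrixP => i j; rewrite !mxE; ring. Qed.

Let lin4 (V : lmodType K) (k : K) (a b c d a' b' c' d' : V) :
  (k *: a + a') - (k *: b + b') - (k *: c + c') + (k *: d + d')
  = k *: (a - b - c + d) + (a' - b' - c' + d').
Proof.
rewrite scalerDr !scalerBr !opprD !addrA.
rewrite [LHS](ACl (1*3*5*7*(2*4*6*8))) /=.
by rewrite !addrA.
Qed.

Let sd1 b c d : linear (fun a : M => schouten_dec a b c d).
Proof.
move=> k x y; rewrite /schouten_dec !lie_linl !wedge3_lin1 !wedge3_lin2.
exact: lin4.
Qed.

Let sd2 a c d : linear (fun b : M => schouten_dec a b c d).
Proof.
move=> k x y; rewrite /schouten_dec !lie_linl !wedge3_lin1 !wedge3_lin2.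
exact: lin4.
Qed.

Let sd3 a b d : linear (fun c : M => schouten_dec a b c d).
Proof.
move=> k x y; rewrite /schouten_dec !lie_linr !wedge3_lin1 !wedge3_lin3.
exact: lin4.
Qed.

Let sd4 a b c : linear (fun d : M => schouten_dec a b c d).
Proof.
move=> k x y; rewrite /schouten_dec !lie_linr !wedge3_lin1 !wedge3_lin3.
exact: lin4.
Qed.

Let sd_skewl a b c d : schouten_dec b a c d = - schouten_dec a b c d
  :> 'M[K]_(n * n * n).
Proof. by apply/matrixP => i j; rewrite !mxE; ring. Qed.

Let sd_skewr a b c d : schouten_dec a b d c = - schouten_dec a b c d
  :> 'M[K]_(n * n * n).
Proof. by apply/matrixP => i j; rewrite !mxE; ring. Qed.

Let unit_sum (a : M) : a = \sum_u a u.1 u.2 *: delta_pair K u.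
Proof. by rewrite {1}(matrix_sum_delta a) pair_bigA. Qed.

Let tcoef_wedge (a b : M) u v :
  tcoef (wedge a b) u v = a u.1 u.2 * b v.1 v.2 - b u.1 u.2 * a v.1 v.2.
Proof. by rewrite /tcoef /wedge !mxE !mxtens_indexK. Qed.

Let bilin_wedge (V : lmodType K) (F : M -> M -> V) (a b : M) :
  2%:R != 0 :> K ->
  (forall y, linear (F^~ y)) -> (forall x, linear (F x)) ->
  (forall x y, F y x = - F x y) ->
  \sum_u \sum_v (tcoef (wedge a b) u v / 2%:R) *:
     F (delta_pair K u) (delta_pair K v)
  = F a b.
Proof.
move=> n2 l1 l2 sk.
have E (x y : M) : \sum_u \sum_v (x u.1 u.2 * y v.1 v.2) *:
                F (delta_pair K u) (delta_pair K v) = F x y.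
  rewrite {2}(unit_sum x) (lin_sum _ _ _ (l1 _)); apply: eq_bigr => u _.
  rewrite (linZ (l1 _)) {2}(unit_sum y) (lin_sum _ _ _ (l2 _)) scaler_sumr.
  by apply: eq_bigr => v _; rewrite (linZ (l2 _)) scalerA.
have -> : F a b = 2%:R^-1 *: (F a b - F b a).
  by rewrite (sk a b) opprK -mulr2n -scaler_nat scalerA mulVf // scale1r.
rewrite -!E -sumrB scaler_sumr; apply: eq_bigr => u _.
rewrite -sumrB scaler_sumr; apply: eq_bigr => v _.
by rewrite -scalerBl scalerA tcoef_wedge mulrC.
Qed.

Lemma schouten_wedge (a b c d : M) : 2%:R != 0 :> K ->
  schouten (wedge a b) (wedge c d) = schouten_dec a b c d.
Proof.
move=> n2; pose F (x y : M) := schouten_dec x y c d.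
have Fl y : linear (F^~ y) by apply: sd1.
have Fr x : linear (F x) by apply: sd2.
rewrite -[RHS]/(F a b) -(bilin_wedge a b n2 Fl Fr) => [|x y];
  last exact: sd_skewl.
apply: eq_bigr => u _; apply: eq_bigr => v _.
pose G := schouten_dec (delta_pair K u) (delta_pair K v).
have Gl y : linear (G^~ y) by apply: sd3.
have Gr x : linear (G x) by apply: sd4.
rewrite -[F _ _]/(G c d) -(bilin_wedge c d n2 Gl Gr) => [|x y];
  last exact: sd_skewr.
rewrite scaler_sumr; apply: eq_bigr => w _.
by rewrite scaler_sumr; apply: eq_bigr => z _; rewrite scalerA.
Qed.

Lemma schouten_linl (s : 'M[K]_(n * n)) : linear (fun r => schouten r s).
Proof.
move=> k x y; rewrite /schouten scaler_sumr -big_split; apply: eq_bigr => u _.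
rewrite scaler_sumr -big_split; apply: eq_bigr => v _.
rewrite scaler_sumr -big_split; apply: eq_bigr => w _.
rewrite scaler_sumr -big_split; apply: eq_bigr => z _ /=.
by rewrite scalerA -scalerDl /tcoef !mxE; congr (_ *: _); ring.
Qed.

Lemma schouten_linr (r : 'M[K]_(n * n)) : linear (schouten r).
Proof.
move=> k x y; rewrite /schouten scaler_sumr -big_split; apply: eq_bigr => u _.
rewrite scaler_sumr -big_split; apply: eq_bigr => v _.
rewrite scaler_sumr -big_split; apply: eq_bigr => w _.
rewrite scaler_sumr -big_split; apply: eq_bigr => z _ /=.
by rewrite scalerA -scalerDl /tcoef !mxE; congr (_ *: _); ring.
Qed.

Lemma ad3_tens (x a b c : M) :
  ad3 x (a *t b *t c)
  = lie x a *t b *t c + a *t lie x b *t c + a *t b *t lie x c.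
Proof.
rewrite /ad3 /lie !mulmxDl !mulmxDr !tensmx_mul !mul1mx !mulmx1.
by apply/matrixP => i j; rewrite !mxE; ring.
Qed.

Lemma Ad2_tens (g a b : M) :
  Ad2 g (a *t b) = (g *m a *m invmx g) *t (g *m b *m invmx g).
Proof. by rewrite /Ad2 !tensmx_mul. Qed.

End Facts.

(* Main.v *)
Require Import Defs.
From HB Require Import structures.
From mathcomp Require Import all_boot all_order all_algebra.
From mathcomp Require Import mxtens mpoly zify.

Import GRing.Theory.
Local Open Scope ring_scope.

(** The closure is reached along a one-parameter subgroup of diagonal matrices.
    Let [mu m] count the points of [tdom t' :\: tdom t] which the orbit of the
    simple root [m] under [tmap t'] visits before it leaves [tdom t'] (lemma
    [potential]).  The step from [m] in [tdom t'] to [tmap t' m] keeps [mu] if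
    [m] lies in [tdom t] and lowers it by one otherwise.

    Extend [mu] additively to the positive roots: [seg mu i j] is the value at
    the root of e_ij.  There is a diagonal matrix g(s) of determinant 1, with
    powers of s as entries, such that conjugation by g(s) multiplies e_ij by
    s ^ (- n * seg mu i j); with the factor n the exponents can be integers of
    sum zero.  Since theta' sends a root vector to a multiple of a root vector
    and acts on its root through [tmap t'] (lemma [theta_emx]), a term
    theta'^k(e_ij) /\ e_ji of the Belavin-Drinfel'd element of [t'] is
    multiplied by s ^ d with d = n * (seg mu i j - seg mu i' j'), where
    theta'^k(e_ij) is proportional to e_i'j'.  This d is a natural number,
    and it is 0 exactly when each of the k steps starts in the domain for [t],
    that is, when the term belongs to the Belavin-Drinfel'd element of [t]
    (lemma [iter_theta_emx]).  As g(s) fixes gamma and the Cartan part, the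
    translates of r' form a polynomial curve in s whose value at s = 0 is r.

    A polynomial which vanishes on the orbit gives, along the curve, a
    polynomial in s with infinitely many roots, hence it vanishes at s = 0 too
    (lemma [lim0_closure]). *)

Section Degeneration.

Set Implicit Arguments.
Unset Strict Implicit.
Unset Printing Implicit Defensive.

Variable K : fieldType.

(** * Zariski limits along polynomial curves *)

(** A limit at 0 without topology: off 0, [f] agrees with a polynomial in s,
    and [L] is the value of that polynomial at 0. *)
Definition lim0 m (f : K -> 'M[K]_m) (L : 'M[K]_m) : Prop :=
  exists F : 'M[{poly K}]_m,
    (forall s, s != 0 -> f s = map_mx (horner_eval s) F)
    /\ L = map_mx (horner_eval 0) F.

(** Composing a polynomial on the space of matrices with the curve gives a
    polynomial in one variable; it has the infinitely many roots 1, 2, 3, ...,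
    so it is zero. *)
Lemma lim0_closure m (W A : 'M[K]_m -> Prop) f L :
  [pchar K] =i pred0 -> lim0 f L -> W L ->
  (forall s, s != 0 -> W (f s) /\ A (f s)) -> zariski_closure W A L.
Proof.
move=> charK [F [Ff ->]] WL WA; split=> // p p0.
pose h (i : 'I_(m * m)) := mxvec F 0 i.
pose q : {poly K} := mmap (@polyC K) h p.
have qE s : q.[s] = p.@[fun i => mxvec (map_mx (horner_eval s) F) 0 i].
  rewrite /q /meval /mmap horner_sum; apply: eq_bigr => u _.
  rewrite hornerM hornerC; congr (_ * _); rewrite /mmap1 horner_prod.
  by apply: eq_bigr => i _; rewrite horner_exp -map_mxvec mxE.
rewrite -qE; suff -> : q = 0 by rewrite horner0.
apply/eqP/negPn/negP => q0; move/pcharf0P: charK => charK.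
pose rs := [seq (k.+1)%:R : K | k <- iota 0 (size q)].
have: (size rs < size q)%N.
  apply: max_poly_roots => //.
    apply/allP => _ /mapP[k _ ->]; apply/rootP; rewrite qE.
    have k0 : (k.+1)%:R != 0 :> K by rewrite charK.
    by have [? ?] := WA _ k0; rewrite -Ff //; apply: p0.
  have le k l : (k.+1)%:R = (l.+1)%:R :> K -> (k <= l)%N.
    move=> /eqP kl; case: ltnP => // lk; move: kl.
    rewrite -subr_eq0 -natrB ?ltnS ?(ltnW lk) // charK.
    by rewrite subSS subn_eq0 leqNgt lk.
  rewrite map_inj_uniq ?iota_uniq // => k l kl.
  by apply/eqP; rewrite eqn_leq !le.
by rewrite size_map size_iota ltnn.
Qed.

Lemma lim0_ext m (f g : K -> 'M[K]_m) L :
  (forall s, s != 0 -> f s = g s) -> lim0 g L -> lim0 f L.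
Proof. by move=> fg [F [Fg FL]]; exists F; split=> // s s0; rewrite fg // Fg. Qed.

(** Only the part of weight 0 survives in the limit. *)
Lemma lim0_power m d (X : 'M[K]_m) :
  lim0 (fun s => s ^+ d *: X) (if d == 0%N then X else 0).
Proof.
exists ('X^d *: map_mx polyC X); split=> [s _|].
  by apply/matrixP => i j; rewrite !mxE /horner_eval hornerM hornerXn hornerC.
apply/matrixP => i j; rewrite !mxE /horner_eval hornerM hornerXn hornerC expr0n.
by case: ifP; rewrite ?mxE ?mul1r ?mul0r.
Qed.

Lemma lim0_cst m (X : 'M[K]_m) : lim0 (fun=> X) X.
Proof.
by apply: lim0_ext (lim0_power 0 X) => s _; rewrite expr0 scale1r.
Qed.

Lemma lim0D m (f g : K -> 'M[K]_m) L N :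
  lim0 f L -> lim0 g N -> lim0 (fun s => f s + g s) (L + N).
Proof.
move=> [F [Ff ->]] [G [Gg ->]]; exists (F + G).
by split=> [s s0|]; rewrite map_mxD // Ff // Gg.
Qed.

Lemma lim0Z m c (f : K -> 'M[K]_m) L :
  lim0 f L -> lim0 (fun s => c *: f s) (c *: L).
Proof.
move=> [F [Ff ->]]; exists (c%:P *: F).
by split=> [s s0|]; rewrite ?Ff //; apply/matrixP => i j;
  rewrite !mxE /horner_eval hornerM hornerC.
Qed.

Lemma lim0_sum m I (r : seq I) (P : pred I) (f : I -> K -> 'M[K]_m) L :
  (forall i, P i -> lim0 (f i) (L i)) ->
  lim0 (fun s => \sum_(i <- r | P i) f i s) (\sum_(i <- r | P i) L i).
Proof.
move=> fL; elim: r => [|i r IH].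
  rewrite big_nil; apply: lim0_ext (lim0_cst 0) => s _; exact: big_nil.
rewrite big_cons; case: ifP => Pi.
  apply: lim0_ext (lim0D (fL i Pi) IH) => s _; by rewrite big_cons Pi.
by apply: lim0_ext IH => s _; rewrite big_cons Pi.
Qed.

Variable n : nat.
Local Notation M := 'M[K]_n.

(** * The exterior square under conjugation *)

Lemma wedgeZl c (a b : M) : wedge (c *: a) b = c *: wedge a b.
Proof.
apply/matrixP => i j; rewrite !mxE mulrBr; congr (_ - _).
  by rewrite mulrA.
by rewrite mulrCA.
Qed.

Lemma wedgeC (a b : M) : wedge b a = - wedge a b.
Proof. by rewrite /wedge opprB. Qed.

Lemma wedgeZr c (a b : M) : wedge a (c *: b) = c *: wedge a b.
Proof. by rewrite wedgeC wedgeZl wedgeC scalerN opprK. Qed.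

Lemma in_wedge2D (P : pred M) r s :
  in_wedge2 P r -> in_wedge2 P s -> in_wedge2 P (r + s).
Proof.
move=> [u uP ->] [v vP ->]; exists (u ++ v); first by rewrite all_cat uP.
by rewrite big_cat.
Qed.

Lemma in_wedge2_sum (P : pred M) I (r : seq I) (Q : pred I) F :
  (forall i, Q i -> in_wedge2 P (F i)) ->
  in_wedge2 P (\sum_(i <- r | Q i) F i).
Proof.
move=> FP; apply: (big_ind (in_wedge2 P)) => //; last exact: in_wedge2D.
by exists [::]; rewrite ?big_nil.
Qed.

Lemma in_wedge2_wedge (P : pred M) a b : P a -> P b -> in_wedge2 P (wedge a b).
Proof. by move=> Pa Pb; exists [:: (a, b)]; rewrite /= ?Pa ?Pb // big_seq1. Qed.

Lemma sl_scale c (x : M) : sl x -> sl (c *: x).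
Proof. by rewrite /sl => /eqP x0; rewrite mxtraceZ x0 mulr0. Qed.

Lemma in_wedge2_slZ c r : in_wedge2 (@sl K n) r -> in_wedge2 (@sl K n) (c *: r).
Proof.
move=> [u uP ->]; rewrite scaler_sumr big_seq.
apply: in_wedge2_sum => p /(allP uP)/andP[p1 p2].
by rewrite -wedgeZl; apply: in_wedge2_wedge => //; apply: sl_scale.
Qed.

Lemma Ad2_wedge (g a b : M) :
  Ad2 g (wedge a b) = wedge (g *m a *m invmx g) (g *m b *m invmx g).
Proof. by rewrite /wedge -!Ad2_tens /Ad2 mulmxBr mulmxBl. Qed.

Lemma Ad2D (g : M) r s : Ad2 g (r + s) = Ad2 g r + Ad2 g s.
Proof. by rewrite /Ad2 mulmxDr mulmxDl. Qed.

Lemma Ad2Z (g : M) c r : Ad2 g (c *: r) = c *: Ad2 g r.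
Proof. by rewrite /Ad2 -scalemxAr -scalemxAl. Qed.

Lemma Ad2_sum (g : M) I (r : seq I) (P : pred I) F :
  Ad2 g (\sum_(i <- r | P i) F i) = \sum_(i <- r | P i) Ad2 g (F i).
Proof. by rewrite /Ad2 mulmx_sumr mulmx_suml. Qed.

Lemma sl_conj (g x : M) : g \in unitmx -> sl x -> sl (g *m x *m invmx g).
Proof. by move=> gU; rewrite /sl mxtrace_mulC mulmxA mulVmx // mul1mx. Qed.

Lemma in_wedge2_Ad2 (g : M) r :
  g \in unitmx -> in_wedge2 (@sl K n) r -> in_wedge2 (@sl K n) (Ad2 g r).
Proof.
move=> gU [u uP ->]; rewrite Ad2_sum big_seq.
apply: in_wedge2_sum => p /(allP uP)/andP[p1 p2].
by rewrite Ad2_wedge; apply: in_wedge2_wedge; apply: sl_conj.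
Qed.

(** Matrix units with indices in [nat], which makes [simple_mx m] equal to
    [emx m m.+1] by definition and avoids casts between ['I_n.-1] and ['I_n]. *)
Definition emx (a b : nat) : M :=
  \matrix_(i, j) ((i == a :> nat) && (j == b :> nat))%:R.

Lemma delta_emx (i j : 'I_n) : delta_mx i j = emx i j.
Proof. by apply/matrixP => a b; rewrite !mxE -!val_eqE. Qed.

Lemma emx_mul a b c d : (b < n)%N -> emx a b *m emx c d = (b == c)%:R *: emx a d.
Proof.
move=> bn; apply/matrixP => i j; rewrite !mxE (bigD1 (Ordinal bn)) //= !mxE.
rewrite big1 => [|k]; last first.
  by rewrite -val_eqE !mxE /= => /negPf ->; rewrite andbF mul0r.
by rewrite addr0 eqxx andbT -!natrM !mulnb andbCA.
Qed.

Lemma emx_neq0 a b : (a < n)%N -> (b < n)%N -> emx a b != 0.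
Proof.
move=> an bn; apply/eqP => /matrixP/(_ (Ordinal an) (Ordinal bn)).
by rewrite !mxE /= !eqxx => /eqP; rewrite oner_eq0.
Qed.

Lemma sl_emx a b : a != b -> sl (emx a b).
Proof.
move=> ab; rewrite /sl; apply/eqP; apply: big1 => i _; rewrite mxE.
by case: eqP => // ->; rewrite (negPf ab).
Qed.

(** * The diagonal torus *)

Definition torus (w : nat -> int) (s : K) : M := diag_mx (\row_i s ^ (w i)).

Section Torus.

Variables (w : nat -> int) (s : K).
Hypothesis s0 : s != 0.

Lemma torusV : torus w s *m torus (fun a => - w a) s = 1%:M.
Proof.
apply/matrixP => i j; rewrite mul_diag_mx !mxE.
case: eqP => [->|_]; last by rewrite mulr0.
by rewrite mulr1n -expfzDr // subrr expr0z.
Qed.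

Lemma torus_unit : torus w s \in unitmx.
Proof. by have [] := mulmx1_unit torusV. Qed.

Lemma torus_inv : invmx (torus w s) = torus (fun a => - w a) s.
Proof. by rewrite -[LHS]mulmx1 -torusV mulKmx ?torus_unit. Qed.

Lemma torus_conjE (x : M) i j :
  (torus w s *m x *m invmx (torus w s)) i j = s ^ (w i - w j) * x i j.
Proof. by rewrite torus_inv mul_mx_diag mul_diag_mx !mxE expfzDr // mulrAC. Qed.

Lemma torus_conj_emx a b :
  torus w s *m emx a b *m invmx (torus w s) = s ^ (w a - w b) *: emx a b.
Proof.
apply/matrixP => i j; rewrite torus_conjE !mxE.
by case: eqP => [->|_]; [case: eqP => [->|_] |]; rewrite ?mulr0.
Qed.

Lemma torus_conj_diag x :
  is_diag_mx x -> torus w s *m x *m invmx (torus w s) = x.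
Proof.
move=> /is_diag_mxP xd; apply/matrixP => i j; rewrite torus_conjE.
have [->|ij] := eqVneq i j; first by rewrite subrr expr0z mul1r.
by rewrite xd ?mulr0 // -val_eqE.
Qed.

Lemma torus_det : \sum_(i < n) w i = 0 -> \det (torus w s) = 1.
Proof.
move=> w0; rewrite det_diag; under eq_bigr => i _ do rewrite mxE.
have expD : {morph exprz s : a b / a + b >-> a * b}.
  by move=> a b; apply: expfzDr.
by rewrite -(big_morph _ expD (expr0z s)) w0 expr0z.
Qed.

End Torus.

(** * Root vectors in the subalgebra generated by simple root vectors *)

Local Notation simple := 'I_n.-1.
Local Notation nilp := Defs.nilp.

(** The root of e_ij is the sum of the simple roots i, ..., j - 1; this says
    that they all lie in [S]. *)
Definition segment_in (S : {set simple}) (i j : nat) : bool :=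
  [forall m : simple, (i <= m < j)%N ==> (m \in S)].

(** Matrices supported on a transitive relation are closed under products,
    hence under brackets. *)
Lemma lie_closure_supp (good : rel 'I_n) (X : seq M) : transitive good ->
  (forall (x : M) i j, x \in X -> ~~ good i j -> x i j = 0) ->
  forall (x : M) i j, x \in lie_closure X -> ~~ good i j -> x i j = 0.
Proof.
move=> good_tr XP.
(* The matrices with the given support form the kernel of a projection. *)
pose mask (x : M) : M := \matrix_(i, j) (if good i j then 0 else x i j).
have mask_lin : linear mask.
  move=> k x y; apply/matrixP => i j; rewrite !mxE.
  by case: ifP; rewrite ?mulr0 ?addr0.
pose maskR : {linear M -> M} :=
  HB.pack mask (GRing.isLinear.Build K M M _ mask mask_lin).
pose maskL := linfun maskR.
have memP (x : M) :
    reflect (forall i j, ~~ good i j -> x i j = 0) (x \in lker maskL).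
  rewrite memv_ker lfunE /=; apply: (iffP eqP) => [/matrixP mx0 i j ij|x0].
    by have := mx0 i j; rewrite !mxE (negPf ij).
  by apply/matrixP => i j; rewrite !mxE; case: ifPn => // /x0.
move=> x i j xX; apply/memP: i j.
apply: (subvP (lie_closure_min _ _)) xX => [y yX|y z /memP y0 /memP z0].
  by apply/memP => i j; apply: XP.
have mul0 (u v : M) i j : (forall a b, ~~ good a b -> u a b = 0) ->
    (forall a b, ~~ good a b -> v a b = 0) -> ~~ good i j -> (u *m v) i j = 0.
  move=> u0 v0 ij; rewrite mxE big1 // => k _.
  have [ik|/u0->] := boolP (good i k); last by rewrite mul0r.
  have [kj|/v0->] := boolP (good k j); last by rewrite mulr0.
  by rewrite (good_tr k) in ij.
apply/memP => i j ij; rewrite /lie !mxE.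
have := mul0 y z i j y0 z0 ij; have := mul0 z y i j z0 y0 ij.
by rewrite !mxE => -> ->; rewrite subrr.
Qed.

Lemma simple_nilp (S : {set simple}) m : m \in S -> simple_mx K m \in nilp K S.
Proof. by move=> mS; apply/subset_lie_closure/map_f; rewrite mem_enum. Qed.

Lemma lie_emxS i j (jn : (j.+1 < n)%N) : (i < j)%N ->
  emx i j.+1 = lie (emx i j) (emx j j.+1).
Proof.
move=> ij; rewrite /lie !emx_mul ?(ltnW jn) // eqxx scale1r.
by rewrite (_ : _ == i = false) ?scale0r ?subr0 //; apply/eqP; lia.
Qed.

Lemma lt_pred j : (j.+1 < n)%N -> (j < n.-1)%N.
Proof. lia. Qed.

Lemma segment_inS (S : {set simple}) i j (jn : (j.+1 < n)%N) : (i <= j)%N ->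
  segment_in S i j.+1 = segment_in S i j && (Ordinal (lt_pred jn) \in S).
Proof.
move=> ij; apply/forallP/andP => [H|[/forallP H jS] m].
  split; last by have := H (Ordinal (lt_pred jn)); rewrite /= ij ltnSn.
  apply/forallP => m; apply/implyP => /andP[im mj].
  by move: (H m); rewrite im ltnS (ltnW mj).
apply/implyP => /andP[im]; rewrite ltnS leq_eqVlt => /orP[/eqP mj|mj].
  by rewrite (_ : m = Ordinal (lt_pred jn)) //; apply: val_inj.
by have := H m; rewrite im mj.
Qed.

(** From right to left e_ij is an iterated bracket of simple root vectors; from
    left to right the subalgebra is supported on the transitive relation
    formed by the segments in [S]. *)
Lemma emx_nilp (S : {set simple}) i j : (i < j)%N -> (j < n)%N ->
  (emx i j \in nilp K S) = segment_in S i j.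
Proof.
move=> ij jn; apply/idP/idP => [eS|].
  pose good (a b : 'I_n) := (a < b)%N && segment_in S a b.
  have good_tr : transitive good.
    move=> b a c /andP[ab /forallP Sab] /andP[bc /forallP Sbc].
    rewrite /good (ltn_trans ab bc); apply/forallP => m.
    apply/implyP => /andP[am mc]; have [mb|bm] := ltnP m b.
      by have := Sab m; rewrite am mb.
    by have := Sbc m; rewrite bm mc.
  have iN : (i < n)%N := ltn_trans ij jn.
  have [/andP[]//|bad] := boolP (good (Ordinal iN) (Ordinal jn)).
  have := lie_closure_supp good_tr _ eS bad; rewrite mxE /= !eqxx => e0.
  suff: (1 : K) = 0 by move/eqP; rewrite oner_eq0.
  apply: e0 => x a b /mapP[m mS ->]; rewrite mxE.
  case: eqP => //= am; case: eqP => //= bm /negP[].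
  rewrite /good am bm ltnSn; apply/forallP => l; apply/implyP => /andP[al lm].
  rewrite mem_enum in mS; rewrite (_ : l = m) //.
  by apply: val_inj; apply/eqP; rewrite eqn_leq -ltnS lm.
elim: j ij jn => // j IH; rewrite ltnS leq_eqVlt => /orP[/eqP ij|ij] jn.
  rewrite segment_inS; last by rewrite ij.
  by move=> /andP[_ jS]; have := simple_nilp jS; rewrite ij.
rewrite (segment_inS _ jn (ltnW ij)) => /andP[Sij jS].
rewrite (lie_emxS jn ij); apply: lie_closure_closed.
  exact: IH (ltnW jn) _.
exact: simple_nilp jS.
Qed.

(** The additive extension of [mu] to positive roots, at the root of e_ij. *)
Definition seg (mu : simple -> nat) (i j : nat) : nat :=
  \sum_(m : simple | (i <= m < j)%N) mu m.

Lemma seg_cat mu i j k : (i <= j)%N -> (j <= k)%N ->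
  seg mu i k = (seg mu i j + seg mu j k)%N.
Proof.
move=> ij jk; rewrite /seg (bigID (fun m : simple => (m < j)%N)) /=.
by congr addn; apply: eq_bigl => m; lia.
Qed.

Lemma seg1 mu (m : simple) : seg mu m m.+1 = mu m.
Proof.
rewrite /seg (big_pred1 m) // => l /=; rewrite -val_eqE /=; lia.
Qed.

(** Writing e_{i,j+1} as the bracket of e_ij and e_{j,j+1}, its image is
    proportional to the bracket of the root vector e_i'j' with the simple root
    vector of T j.  This bracket is a root vector which prolongs i', ..., j' at
    one end, or it is zero, which injectivity excludes. *)
Lemma theta_emx (t : triple n) (theta : 'End(M)) : BD_iso t theta ->
  forall i j, (i < j)%N -> (j < n)%N -> segment_in (tdom t) i j ->
  exists c i' j', [/\ c != 0, (i' < j')%N, (j' < n)%N,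
      theta (emx i j) = c *: emx i' j'
    & forall mu, seg mu i' j' = seg (mu \o tmap t) i j].
Proof.
move=> [_ inj_th lie_th simple_th] i; elim=> // j IH.
rewrite ltnS leq_eqVlt => ij jn Sij.
have le_ij : (i <= j)%N by rewrite leq_eqVlt.
move: Sij; rewrite (segment_inS _ jn le_ij) => /andP[Sij jS].
set m := Ordinal _ in jS.
have Tn : ((tmap t m).+1 < n)%N by have := ltn_ord (tmap t m); lia.
case/orP: ij => [/eqP ij|ij].
  exists 1, (tmap t m : nat), (tmap t m).+1; split; rewrite ?oner_eq0 //.
    by rewrite scale1r ij; apply: simple_th jS.
  by move=> mu; rewrite seg1 ij (seg1 _ m).
have [c [i' [j' [c0 ij' jn' thE segE]]]] := IH ij (ltnW jn) Sij.
have eij : emx i j \in nilp K (tdom t) by rewrite emx_nilp // ltnW.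
have thS : theta (emx i j.+1)
    = c *: lie (emx i' j') (emx (tmap t m) (tmap t m).+1).
  rewrite (lie_emxS jn ij) lie_th //; last exact: simple_nilp jS.
  by rewrite thE (simple_th m jS) /lie -!scalemxAl -!scalemxAr -scalerBr.
have segS mu : seg (mu \o tmap t) i j.+1
    = (seg mu i' j' + mu (tmap t m))%N.
  by rewrite (seg_cat _ le_ij (leqnSn j)) segE (seg1 _ m).
rewrite /lie !emx_mul // in thS.
have [jT|jT] := eqVneq j' (tmap t m : nat).
  exists c, i', (tmap t m).+1; split=> //.
  - by rewrite -jT; lia.
  - rewrite thS jT eqxx scale1r (_ : _ == i' = false) ?scale0r ?subr0 //.
    by apply/eqP; lia.
  by move=> mu; rewrite segS jT (@seg_cat _ i' (tmap t m)) ?seg1 //; lia.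
have [iT|iT] := eqVneq (tmap t m).+1 i'.
  exists (- c), (tmap t m : nat), j'; split=> //; first by rewrite oppr_eq0.
  - by lia.
  - by rewrite thS (negPf jT) iT eqxx scale0r sub0r scale1r scalerN scaleNr.
  move=> mu; rewrite segS addnC.
  rewrite (@seg_cat _ (tmap t m) (tmap t m).+1) ?seg1 -?iT //; lia.
(* The bracket vanishes in the remaining case. *)
have eijS : emx i j.+1 \in nilp K (tdom t).
  by rewrite emx_nilp ?segment_inS ?Sij ?ltnS.
have /negP[] := emx_neq0 (ltn_trans ij (ltnW jn)) jn.
apply/eqP/inj_th; rewrite ?mem0v // thS.
by rewrite (negPf jT) (negPf iT) !scale0r subr0 scaler0 linear0.
Qed.

Lemma nilpS (S S' : {set simple}) : S \subset S' -> (nilp K S <= nilp K S')%VS.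
Proof.
move=> SS'; apply: lie_closure_min; last exact: lie_closure_closed.
move=> _ /mapP[m mS ->]; apply: simple_nilp; apply: (subsetP SS').
by rewrite -mem_enum.
Qed.

(** Both maps are Lie homomorphisms with the same values on generators. *)
Lemma BD_iso_prec (t t' : triple n) (theta theta' : 'End(M)) :
  triple_prec t t' ->
  BD_iso t theta -> BD_iso t' theta' ->
  {in nilp K (tdom t), theta =1 theta'}.
Proof.
move=> [SS' TT'] [_ _ lie_th simple_th] [_ _ lie_th' simple_th'] x xS.
have sub := subvP (nilpS SS').
have: (nilp K (tdom t) <= nilp K (tdom t) :&: lker (theta - theta'))%VS.
  apply: lie_closure_min => [_ /mapP[m mS ->]|y z].
    rewrite mem_enum in mS; rewrite memv_cap simple_nilp //= memv_ker.
    rewrite add_lfunE opp_lfunE simple_th // simple_th' ?(subsetP SS') //.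
    by rewrite TT' // subrr.
  rewrite !memv_cap !memv_ker !add_lfunE !opp_lfunE !subr_eq0.
  move=> /andP[yS /eqP yE] /andP[zS /eqP zE].
  rewrite [_ \in _]lie_closure_closed //=.
  by rewrite lie_th // lie_th' ?sub // yE zE.
move/subvP/(_ x xS); rewrite memv_cap memv_ker add_lfunE opp_lfunE subr_eq0.
by case/andP=> _ /eqP.
Qed.

(** The condition under which [iter k theta x] contributes to the
    Belavin-Drinfel'd element: every earlier iterate lies in the domain. *)
Definition stays (t : triple n) (theta : 'End(M)) (x : M) (k : nat) : bool :=
  [forall l : 'I_k, iter l theta x \in nilp K (tdom t)].

Lemma staysP (t : triple n) (theta : 'End(M)) x k :
  reflect (forall l, (l < k)%N -> iter l theta x \in nilp K (tdom t))
          (stays t theta x k).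
Proof.
apply: (iffP forallP) => [H l lk|H l]; first exact: H (Ordinal lk).
exact: H.
Qed.

Lemma staysS (t : triple n) (theta : 'End(M)) x k : stays t theta x k.+1
  = stays t theta x k && (iter k theta x \in nilp K (tdom t)).
Proof.
apply/staysP/andP => [H|[/staysP H xk] l].
  by split; [apply/staysP => l lk; apply: H; apply: ltnW | apply: H].
by rewrite ltnS leq_eqVlt => /orP[/eqP->|/H].
Qed.

Lemma stays_prec (t t' : triple n) (theta theta' : 'End(M)) x k :
  triple_prec t t' ->
  BD_iso t theta -> BD_iso t' theta' -> stays t theta x k ->
  stays t' theta' x k /\ iter k theta x = iter k theta' x.
Proof.
move=> tt' th th'; elim: k => [|k IH]; first by split=> //; apply/staysP.
rewrite !staysS => /andP[/IH[-> E] xk]; split.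
  by rewrite -E; apply: (subvP (nilpS tt'.1)).
by rewrite /= -E; apply: (BD_iso_prec tt' th th').
Qed.

(** * A potential for the arrows of the larger triple *)

(** [mu m] is the number of points outside [tdom t] that the orbit of [m] under
    [tmap t'] visits before it leaves [tdom t']. *)
Lemma potential (t t' : triple n) : admissible t' ->
  exists mu : simple -> nat, forall m, m \in tdom t' ->
    mu m = ((m \notin tdom t) + mu (tmap t' m))%N.
Proof.
move=> [_ _ nil _].
have ex m : exists r, iter r (tmap t') m \notin tdom t'.
  have [/nil[r [_ _ ?]]|?] := boolP (m \in tdom t'); first by exists r.
  by exists 0%N.
pose len m := ex_minn (ex m).
exists (fun m => \sum_(l < len m) (iter l (tmap t') m \notin tdom t))%N => m mS.
have -> : len m = (len (tmap t' m)).+1.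
  rewrite /len; case: ex_minnP => r rP rmin; case: ex_minnP => q qP qmin.
  apply/eqP; rewrite eqn_leq rmin ?iterSr //=.
  case: r rP rmin => [|r] rP _; rewrite ?mS // in rP *.
  by rewrite ltnS qmin // -iterSr.
by rewrite big_ord_recl; congr addn; apply: eq_bigr => l _; rewrite -iterSr.
Qed.

(** Each application of theta' to a root vector lowers [seg mu] by the number
    of simple roots of its segment outside [tdom t], so [seg mu] is unchanged
    after k steps if and only if each of them starts in the subalgebra of
    [tdom t]. *)
Lemma iter_theta_emx (t t' : triple n) (theta theta' : 'End(M)) mu :
  triple_prec t t' -> BD_iso t theta -> BD_iso t' theta' ->
  (forall m, m \in tdom t' -> mu m = ((m \notin tdom t) + mu (tmap t' m))%N) ->
  forall i j k, (i < j)%N -> (j < n)%N -> stays t' theta' (emx i j) k ->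
  exists c i' j', [/\ c != 0, (i' < j')%N, (j' < n)%N,
      iter k theta' (emx i j) = c *: emx i' j'
    & (seg mu i' j' <= seg mu i j)%N /\
      (seg mu i' j' == seg mu i j) = stays t theta (emx i j) k].
Proof.
move=> tt' th th' muP i j k ij jn; elim: k => [_|k IH].
  exists 1, i, j; split; rewrite ?oner_eq0 ?scale1r //.
  by split; rewrite // eqxx; symmetry; apply/staysP.
rewrite staysS => /andP[/IH[c [a [b [c0 ab bn E [le eq]]]]]].
rewrite E rpredZeq (negPf c0) /= emx_nilp // => Sab.
have [c' [a' [b' [c'0 ab' bn' E' segE]]]] := theta_emx th' ab bn Sab.
have segD : seg mu a b
    = (seg (fun m => m \notin tdom t) a b + seg mu a' b')%N.
  rewrite segE /seg -big_split; apply: eq_bigr => m abm.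
  by rewrite muP //; move/forallP/(_ m): Sab; rewrite abm.
have seg0 : (seg (fun m => m \notin tdom t) a b == 0%N) =
    segment_in (tdom t) a b.
  rewrite sum_nat_eq0; apply: eq_forallb => m.
  by rewrite eqb0 negbK.
exists (c * c'), a', b'; split; rewrite ?mulf_neq0 //.
  by rewrite /= E linearZ /= E' scalerA.
split; first by rewrite (leq_trans _ le) // segD leq_addl.
have -> : stays t theta (emx i j) k.+1
    = stays t theta (emx i j) k && segment_in (tdom t) a b.
  rewrite staysS; have [st|//] := boolP (stays _ _ _ _).
  by rewrite (stays_prec tt' th th' st).2 E rpredZeq (negPf c0) emx_nilp.
rewrite -eq -seg0; lia.
Qed.

(** * The three parts of the solution *)

Lemma BD_alphaE (t : triple n) (theta : 'End(M)) : BD_alpha t theta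
  = 2%:R *: \sum_(i < n) \sum_(j < n | (i < j)%N)
      \sum_(1 <= k < n | stays t theta (emx i j) k)
        wedge (iter k theta (emx i j)) (emx j i).
Proof.
rewrite /BD_alpha; congr (_ *: _); apply: eq_bigr => i _.
rewrite big_mkcondr; apply: eq_bigr => j ij.
rewrite !delta_emx; case: ifPn => // e0.
rewrite big_nat_cond big1 // => k /andP[/andP[k0 _]] /staysP/(_ _ k0) /= e1.
by rewrite e1 in e0.
Qed.

Lemma Ad2_torus_gamma w s : s != 0 -> Ad2 (torus w s) (gamma K n) = gamma K n.
Proof.
move=> s0; rewrite Ad2_sum; apply: eq_bigr => i _; rewrite Ad2_sum.
apply: eq_bigr => j _; rewrite Ad2_wedge !delta_emx !torus_conj_emx //.
rewrite wedgeZl wedgeZr scalerA -expfzDr // addrC subrKA subrr expr0z.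
exact: scale1r.
Qed.

Lemma Ad2_torus_cartan w s beta : s != 0 ->
  in_wedge2 (@cartan K n) beta -> Ad2 (torus w s) beta = beta.
Proof.
move=> s0 [u uP ->]; rewrite Ad2_sum !big_seq; apply: eq_bigr => p.
move=> /(allP uP)/andP[/andP[p1 _] /andP[p2 _]].
by rewrite Ad2_wedge !torus_conj_diag.
Qed.

Lemma gamma_sl : in_wedge2 (@sl K n) (gamma K n).
Proof.
apply: in_wedge2_sum => i _; apply: in_wedge2_sum => j ij.
by rewrite !delta_emx; apply: in_wedge2_wedge; apply: sl_emx; lia.
Qed.

Lemma cartan_sl beta : in_wedge2 (@cartan K n) beta -> in_wedge2 (@sl K n) beta.
Proof.
move=> [u uP ->]; exists u => //; apply: sub_all uP => p.
by move=> /andP[/andP[_ p1] /andP[_ p2]]; apply/andP.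
Qed.

Lemma BD_alpha_sl (t : triple n) (theta : 'End(M)) :
  BD_iso t theta -> in_wedge2 (@sl K n) (BD_alpha t theta).
Proof.
move=> th; rewrite BD_alphaE; apply: in_wedge2_slZ.
apply: in_wedge2_sum => i _; apply: in_wedge2_sum => j ij.
apply: in_wedge2_sum => k st.
have mu0 m : m \in tdom t -> 0%N = ((m \notin tdom t) + 0)%N by move=> ->.
have tt : triple_prec t t by split.
have [c [a [b [_ ab _ -> _]]]] := iter_theta_emx tt th th mu0 ij (ltn_ord j) st.
by apply: in_wedge2_wedge; first apply: sl_scale; apply: sl_emx; lia.
Qed.

(** The weight of each term is a natural number, which is zero exactly for the
    terms that the two Belavin-Drinfel'd elements share. *)
Lemma BD_alpha_lim0 (t t' : triple n) (theta theta' : 'End(M)) mu w :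
  triple_prec t t' -> BD_iso t theta -> BD_iso t' theta' ->
  (forall m, m \in tdom t' -> mu m = ((m \notin tdom t) + mu (tmap t' m))%N) ->
  (forall a b, (a <= b)%N -> w b - w a = (seg mu a b * n)%:Z) ->
  lim0 (fun s => Ad2 (torus w s) (BD_alpha t' theta')) (BD_alpha t theta).
Proof.
move=> tt' th th' muP wseg.
pose term i j k := wedge (iter k theta' (emx i j)) (emx j i).
have limterm (i j : 'I_n) k : (i < j)%N -> stays t' theta' (emx i j) k ->
    lim0 (fun s => Ad2 (torus w s) (term i j k))
         (if stays t theta (emx i j) k then term i j k else 0).
  move=> ij /(iter_theta_emx tt' th th' muP ij (ltn_ord j)).
  rewrite /term => -[c [a [b [c0 ab bn -> [le eq]]]]].
  pose d := ((seg mu i j - seg mu a b) * n)%N.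
  have -> : stays t theta (emx i j) k = (d == 0%N).
    rewrite -eq muln_eq0 subn_eq0 eqn_leq le.
    by rewrite (gtn_eqF (leq_ltn_trans _ bn)) ?orbF.
  apply: lim0_ext (lim0_power _ _) => s s0.
  rewrite Ad2_wedge -scalemxAr -scalemxAl !torus_conj_emx //.
  rewrite !(wedgeZl, wedgeZr) !scalerA; congr (_ *: _).
  rewrite -mulrA -expfzDr // mulrC exprnP; congr (s ^ _ * c).
  rewrite -(opprB (w b)) !wseg ?(ltnW ab) ?(ltnW ij) // addrC.
  by rewrite subzn ?leq_mul2r ?le ?orbT // -mulnBl.
rewrite !BD_alphaE.
apply: lim0_ext => [s s0|]; first by rewrite Ad2Z Ad2_sum; reflexivity.
apply: lim0Z; apply: lim0_sum => i _.
apply: lim0_ext => [s s0|]; first by rewrite Ad2_sum; reflexivity.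
apply: lim0_sum => j ij.
(* The terms of t are those terms of t' whose weight is zero. *)
have -> : \sum_(1 <= k < n | stays t theta (emx i j) k)
      wedge (iter k theta (emx i j)) (emx j i)
  = \sum_(1 <= k < n | stays t' theta' (emx i j) k)
     if stays t theta (emx i j) k then term i j k else 0.
  rewrite -big_mkcondr [LHS]big_mkcond [RHS]big_mkcond.
  apply: eq_bigr => k _; have [st|_] := boolP (stays t _ _ _).
    by rewrite /term; have [-> ->] := stays_prec tt' th th' st.
  by rewrite andbF.
apply: lim0_ext => [s s0|]; first by rewrite Ad2_sum; reflexivity.
by apply: lim0_sum => k; apply: limterm.
Qed.

End Degeneration.

Theorem mainTheorem3 (K : fieldType) (charK : [pchar K] =i pred0) (n : nat)
    (t t' : triple n) (theta theta' : 'End('M[K]_n)) (beta : 'M[K]_(n * n)) :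
  admissible t -> admissible t' -> triple_prec t t' ->
  BD_iso t theta -> BD_iso t' theta' ->
  in_wedge2 (@cartan K n) beta ->
  MCYBE (gamma K n + beta + BD_alpha t' theta') ->
  zariski_closure (in_wedge2 (@sl K n))
    (SL_orbit (gamma K n + beta + BD_alpha t' theta'))
    (gamma K n + beta + BD_alpha t theta).
Proof.
move=> _ adm' tt' th th' betaP [r'P _ _ _].
have [mu muP] := potential t adm'.
(* Subtracting the mean of the heights makes the exponents add up to zero;
   multiplying by n keeps them integers. *)
pose ht a : int := (seg mu 0 a)%:Z.
pose w a : int := ht a * n%:Z - \sum_(i < n) ht i.
have w0 : \sum_(i < n) w i = 0.
  by rewrite sumrB -mulr_suml sumr_const card_ord -mulr_natr natz subrr.
have wseg a b : (a <= b)%N -> w b - w a = (seg mu a b * n)%:Z.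
  by move=> ab; rewrite /w /ht (@seg_cat n mu 0 a b) //; lia.
apply: (@lim0_closure K _ _ _ (fun s => Ad2 (torus n w s)
          (gamma K n + beta + BD_alpha t' theta')) _ charK).
- apply: (@lim0_ext _ _ _ (fun s =>
      gamma K n + beta + Ad2 (torus n w s) (BD_alpha t' theta'))).
    move=> s s0; rewrite !Ad2D (Ad2_torus_gamma _ _ s0).
    by rewrite (Ad2_torus_cartan _ s0 betaP).
  exact: lim0D (lim0_cst _) (BD_alpha_lim0 tt' th th' muP wseg).
- apply: in_wedge2D (BD_alpha_sl th).
  exact: in_wedge2D (gamma_sl _ _) (cartan_sl betaP).
move=> s s0; split; first by apply: in_wedge2_Ad2 => //; apply: torus_unit.
by exists (torus n w s) => //; apply: torus_det.
Qed.
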